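(* Let $m\ge 2$, $n\ge 1$, let $\mathcal T\in\mathbb T(\mathbb C^n,m)$ and let $\lambda\in\sigma(\mathcal T)$ be an eigenvalue of $\mathcal T$. Suppose that for some $n\times n$ permutation matrix $P$, $$V_{\mathcal T}(\lambda)\supseteq P\{\mathbf x\in\mathbb C^n : x_{\operatorname{gm}(\lambda)+1}=\dots=x_n=0\}:=\{P\mathbf x : \mathbf x\in\mathbb C^n,\ x_{\operatorname{gm}(\lambda)+1}=\dots=x_n=0\}.$$ Then $$\operatorname{am}(\lambda)\geq \operatorname{gm}(\lambda)(m-1)^{\operatorname{gm}(\lambda)-1}.$$
   Context: $\mathbb T(\mathbb C^n,m)=\otimes^m\mathbb C^n$ is the space of $m$-th order $n$-dimensional tensors $\mathcal T=(t_{i_1\ldots i_m})_{1\le i_1,\dots,i_m\le n}$ with complex entries. For $\mathbf x\in\mathbb C^n$, $\mathcal T\mathbf x^{m-1}\in\mathbb C^n$ has $i$-th entry $\sum_{i_2,\dots,i_m=1}^n t_{ii_2\ldots i_m}x_{i_2}\cdots x_{i_m}$, and $\mathbf x^{[m-1]}$ has $i$-th entry $x_i^{m-1}$. The identity tensor $\mathcal I$ has entries $1$ when $i_1=\dots=i_m$ and $0$ otherwise, so $\mathcal I\mathbf x^{m-1}=\mathbf x^{[m-1]}$. A number $\lambda\in\mathbb C$ is an eigenvalue of $\mathcal T$ if there is $\mathbf x\in\mathbb C^n\setminus\{\mathbf 0\}$ with $\mathcal T\mathbf x^{m-1}=\lambda\mathbf x^{[m-1]}$; $\sigma(\mathcal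 T)$ is the set of eigenvalues. The eigenvariety is $V_{\mathcal T}(\lambda)=\{\mathbf x\in\mathbb C^n:\mathcal T\mathbf x^{m-1}=\lambda\mathbf x^{[m-1]}\}$ (with $\mathbf 0$ included), regarded as an affine variety in $\mathbb C^n$. The determinant $\operatorname{Det}(\mathcal T)$ is the classical resultant $\operatorname{Res}(f_1,\dots,f_n)$ of the $n$ homogeneous polynomials $f_i(\mathbf x)=(\mathcal T\mathbf x^{m-1})_i$ of degree $m-1$ in $n$ variables. Here the resultant of degrees $(d,\dots,d)$ is the unique irreducible integer polynomial in the coefficients of $f_1,\dots,f_n$ that vanishes if and only if $f_1=\dots=f_n=0$ has a nontrivial solution in $\mathbb C^n$, normalized by $\operatorname{Res}(x_1^d,\dots,x_n^d)=1$. The characteristic polynomial of $\mathcal T$ is $\chi(\lambda)=\operatorname{Det}(\lambda\mathcal I-\mathcal T)$, a monic polynomial of degree $n(m-1)^{n-1}$ whose roots are exactly the eigenvalues of $\mathcal T$. The algebraic multiplicity $\operatorname{am}(\lambda)$ is the multiplicity of $\lambda$ as a root of $\chi$; the geometric multiplicity $\operatorname{gm}(\lambda)$ is the dimension of the affine variety $V_{\mathcal T}(\lambda)\subseteq\mathbb C^n$. *)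

(* Defs.v *)
From HB Require Import structures.
From mathcomp Require Import all_boot all_order all_algebra.
From mathcomp Require Import classical_sets reals.
From mathcomp Require Import complex.
From mathcomp Require Import mpoly.

Set Implicit Arguments.
Unset Strict Implicit.
Unset Printing Implicit Defensive.

Import GRing.Theory.
Local Open Scope ring_scope.
Local Open Scope classical_set_scope.

(** * Tensors *)

(* The entry t_{i_1 ... i_m} of T is T [tuple i_1; ...; i_m]. *)
Definition tensor (A : Type) (n m : nat) := {ffun m.-tuple 'I_n -> A}.

(* The i-th entry of T x^{m-1}: the sum runs over the multi-indices
   (i, i_2, ..., i_m), i.e. those whose first index is i. *)
Definition tensor_apply (A : comNzRingType) (n m : nat) (T : tensor A n m)
    (x : 'cV[A]_n) : 'cV[A]_n :=
  \col_i \sum_(j : m.-tuple 'I_n | ohead j == Some i)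
     T j * \prod_(k <- behead j) x k 0.

Definition power_vec (A : comNzRingType) (n d : nat) (x : 'cV[A]_n) :
    'cV[A]_n := \col_i x i 0 ^+ d.

(* The form f_i = (T x^{m-1})_i as a polynomial in x_1, ..., x_n. *)
Definition tensor_form (A : comNzRingType) (n m : nat) (T : tensor A n m)
    (i : 'I_n) : {mpoly A[n]} :=
  \sum_(j : m.-tuple 'I_n | ohead j == Some i)
     T j *: \prod_(k <- behead j) 'X_k.

Definition id_tensor (A : comNzRingType) (n m : nat) : tensor A n m :=
  [ffun j : m.-tuple 'I_n => (constant j)%:R].

Definition is_eigenvalue (F : fieldType) (n m : nat) (T : tensor F n m)
    (lam : F) : Prop :=
  exists x : 'cV[F]_n,
    x != 0 /\ tensor_apply T x = lam *: power_vec m.-1 x.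

Definition eigenvariety (F : fieldType) (n m : nat) (T : tensor F n m)
    (lam : F) : set 'cV[F]_n :=
  [set x | tensor_apply T x = lam *: power_vec m.-1 x].

(** * The resultant of n forms of degree d in n variables *)

(* The indeterminates of the resultant are the coefficients u_(i, a) of the
   monomials 'X^a of degree d in the i-th generic form. *)
Definition coef_index (n d : nat) : finType :=
  ('I_n * {a : 'X_{1..n < d.+1} | mdeg a == d})%type.

Definition form_coef_poly (n d : nat) := {mpoly int[#|coef_index n d|]}.

(* Substitution in an integer polynomial P of the coefficients of f_i for the
   indeterminates u_(i, a). *)
Definition coef_eval (A : comNzRingType) (n d : nat) (P : form_coef_poly n d)
    (f : 'I_n -> {mpoly A[n]}) : A :=
  mmap (fun z : int => z%:~R)
       (fun k : 'I_#|coef_index n d| =>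
          let ia := enum_val k in (f ia.1)@_(val ia.2)) P.

Definition irreducible_elt (A : idomainType) (p : A) : Prop :=
  [/\ p != 0, p \isn't a GRing.unit &
      forall a b : A, p = a * b -> a \is a GRing.unit \/ b \is a GRing.unit].

(* These three properties determine P uniquely (for 0 < n, 0 < d and F an
   algebraically closed field of characteristic 0). *)
Definition is_resultant (F : fieldType) (n d : nat) (P : form_coef_poly n d) :
    Prop :=
  [/\ irreducible_elt P,
      forall f : 'I_n -> {mpoly F[n]}, (forall i, f i \is d.-homog) ->
        (coef_eval P f = 0 <->
         exists x : 'cV[F]_n,
           x != 0 /\ forall i, (f i).@[fun k => x k 0] = 0) &
      coef_eval P (fun i : 'I_n => 'X_i ^+ d : {mpoly F[n]}) = 1].

(** * Determinant and characteristic polynomial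

    Here [Res] is the resultant for n forms of degree m - 1. *)

Definition tensor_det (A : comNzRingType) (n m : nat)
    (Res : form_coef_poly n m.-1) (T : tensor A n m) : A :=
  coef_eval Res (tensor_form T).

(* The determinant of lambda I - T, computed over F[lambda]. *)
Definition tensor_char_poly (F : fieldType) (n m : nat)
    (Res : form_coef_poly n m.-1) (T : tensor F n m) : {poly F} :=
  tensor_det Res
    ([ffun j => 'X * id_tensor {poly F} n m j - (T j)%:P]
       : tensor {poly F} n m).

Definition alg_mult (F : fieldType) (n m : nat) (Res : form_coef_poly n m.-1)
    (T : tensor F n m) (lam : F) : nat :=
  mup lam (tensor_char_poly Res T).

(** * Dimension of subsets of affine space for the Zariski topology *)

Definition zariski_closed (F : fieldType) (n : nat) (Z : set 'cV[F]_n) :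
    Prop :=
  exists S : set {mpoly F[n]},
    Z = [set x | forall p, S p -> p.@[fun k => x k 0] = 0].

Definition irreducible_closed (F : fieldType) (n : nat) (Z : set 'cV[F]_n) :
    Prop :=
  [/\ zariski_closed Z, Z !=set0 &
      forall A B : set 'cV[F]_n, zariski_closed A -> zariski_closed B ->
        Z `<=` A `|` B -> Z `<=` A \/ Z `<=` B].

(* A strictly increasing chain Z_0, ..., Z_k of irreducible closed sets
   inside V. *)
Definition has_irreducible_chain (F : fieldType) (n : nat)
    (V : set 'cV[F]_n) (k : nat) : Prop :=
  exists Z : nat -> set 'cV[F]_n,
    (forall i, (i <= k)%N -> irreducible_closed (Z i) /\ Z i `<=` V) /\
    (forall i, (i < k)%N -> Z i `<` Z i.+1).

Definition is_variety_dim (F : fieldType) (n : nat) (V : set 'cV[F]_n)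
    (d : nat) : Prop :=
  has_irreducible_chain V d /\
  forall k, has_irreducible_chain V k -> (k <= d)%N.

Definition is_geom_mult (F : fieldType) (n m : nat) (T : tensor F n m)
    (lam : F) (g : nat) : Prop :=
  is_variety_dim (eigenvariety T lam) g.

(* The vectors with x_{g+1} = ... = x_n = 0; indices start at 0 here. *)
Definition coord_subspace (F : fieldType) (n g : nat) : set 'cV[F]_n :=
  [set x | forall i : 'I_n, (g <= i)%N -> x i 0 = 0].
Arguments coord_subspace : clear implicits.

(* Main.v *)
(* After the substitution t = lam + s, the characteristic polynomial is the
   resultant of the forms s x_k^d + h_k, where d = m - 1 and every h_k vanishes
   on a coordinate subspace L of dimension g = gm(lam), whose coordinates form
   a set S.  Give each equation its own variable s_k.  For i in S, perturb with
   a parameter eps: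
     s_i x_i^d - x_i^(d-1) sum_(j <> i) eps^(j+1) x_j + h_i   (equation i),
     s_k prod_(r < d) (x_k - r eps x_i) + h_k                 (k <> i).
   For every phi : S \ i -> {0, ..., d-1}, the point x_i = 1,
   x_k = eps phi_k of L is a common zero when
   s_i = sum_j phi_j eps^(j+2).  This gives d^(g-1) distinct roots in s_i,
   all tending to 0 with eps, so s_i^(d^(g-1)) divides the unperturbed
   resultant.  This holds for each i in S, so the product of these powers
   divides it, and s^(g d^(g-1)) does after setting all s_k = s.

   That g <= n follows from dim C^n <= n: separating polynomials along a chain
   of irreducible closed sets are algebraically independent, whereas n + 1
   polynomials in n variables are dependent by a count of monomials. *)
Require Import Defs.
From HB Require Import structures.
From mathcomp Require Import all_boot all_order all_algebra.
From mathcomp Require Import fingroup perm.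
From mathcomp Require Import classical_sets reals.
From mathcomp Require Import complex.
From mathcomp Require Import mpoly.

Import GRing.Theory.
Local Open Scope ring_scope.
Local Open Scope complex_scope.
Local Open Scope classical_set_scope.

Set Implicit Arguments.
Unset Strict Implicit.

(** * Dimension of affine space *)

(** With [D = (A+1)^n + 1] one has [(A*D + 1)^n <= (A+1)^n * D^n < D^(n+1)]. This makes products
    with exponents below [D] outnumber the monomials available to them. *)
Lemma expn_lin_lt (A n : nat) : exists D : nat, ((A * D).+1 ^ n < D ^ n.+1)%N.
Proof.
exists (A.+1 ^ n).+1%N; move D_def: (A.+1 ^ n).+1%N => D.
have le : ((A * D).+1 <= A.+1 * D)%N by rewrite mulSn -add1n leq_add2r -D_def.
apply: (@leq_ltn_trans ((A.+1 * D) ^ n)%N).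
  by case: n {D_def} => // n'; rewrite leq_exp2r.
by rewrite expnMn expnS ltn_pmul2r -?D_def ?expn_gt0.
Qed.

(** The zero sets of [p] and [q] are closed and cover [Z], so irreducibility puts [Z] inside one of
    them. *)
Lemma irreducible_closed_mul0 (F : fieldType) (n : nat) (Z : set 'cV[F]_n)
    (p q : {mpoly F[n]}) :
  irreducible_closed Z ->
  (forall x, Z x -> p.@[fun k => x k 0] * q.@[fun k => x k 0] = 0) ->
  (forall x, Z x -> p.@[fun k => x k 0] = 0) \/
  (forall x, Z x -> q.@[fun k => x k 0] = 0).
Proof.
case=> _ _ irr pq0.
have zc (r : {mpoly F[n]}) :
    zariski_closed [set x : 'cV[F]_n | r.@[fun k => x k 0] = 0].
  exists [set r]; apply/seteqP; split=> x /= rx; last exact: rx.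
  by move=> p' ->.
apply: (irr _ _ (zc p) (zc q)) => x Zx /=.
by move/eqP: (pq0 x Zx); rewrite mulf_eq0 => /orP[] /eqP; [left | right].
Qed.

(** A point of [Z i.+1] outside [Z i] violates one of the equations that define the closed set
    [Z i]. *)
Lemma chain_separating (F : fieldType) (n k : nat) (V : set 'cV[F]_n)
    (Z : nat -> set 'cV[F]_n) :
  (forall i, (i <= k)%N -> irreducible_closed (Z i) /\ Z i `<=` V) ->
  (forall i, (i < k)%N -> Z i `<` Z i.+1) ->
  exists a : nat -> {mpoly F[n]}, forall i, (i < k)%N ->
    (forall x, Z i x -> (a i).@[fun j => x j 0] = 0) /\
    (exists2 x, Z i.+1 x & (a i).@[fun j => x j 0] != 0).
Proof.
move=> Zirr Zlt.
suff H i : exists a : {mpoly F[n]}, (i < k)%N ->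
    (forall x, Z i x -> a.@[fun j => x j 0] = 0) /\
    (exists2 x, Z i.+1 x & a.@[fun j => x j 0] != 0).
  by have [a Ha] := boolp.choice H; exists a.
have [lt_ik|] := boolP (i < k)%N; last by exists 0.
have [[[S defZ] _ _] _] := Zirr i (ltnW lt_ik).
have [_ ZSi] := Zlt i lt_ik.
have [x [Zx nZx]] := nonsubset ZSi.
have /boolp.existsNP [a] : ~ (forall p, S p -> p.@[fun j => x j 0] = 0).
  by move=> Sx; apply: nZx; rewrite defZ.
move=> /boolp.not_implyP [Sa /eqP ax]; exists a => _; split; last by exists x.
by move=> y; rewrite defZ; apply.
Qed.

(* Going down the chain, only the terms with the least exponent of [a_l]
   survive the restriction from [Z_(l+1)] to [Z_l]: divide by the common power
   of [a_l], which does not vanish identically on [Z_(l+1)], and then use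
   [a_l = 0] on [Z_l].  On [Z_0] a single term is left. *)
Lemma chain_alg_indep (F : fieldType) (n k D : nat) (V : set 'cV[F]_n)
    (Z : nat -> set 'cV[F]_n) (a : nat -> {mpoly F[n]})
    (c : {ffun 'I_k -> 'I_D} -> F) :
  (forall i, (i <= k)%N -> irreducible_closed (Z i) /\ Z i `<=` V) ->
  (forall i, (i < k)%N -> Z i `<` Z i.+1) ->
  (forall i, (i < k)%N ->
    (forall x, Z i x -> (a i).@[fun j => x j 0] = 0) /\
    (exists2 x, Z i.+1 x & (a i).@[fun j => x j 0] != 0)) ->
  \sum_phi c phi *: \prod_(i < k) a i ^+ phi i = 0 -> forall phi, c phi = 0.
Proof.
move=> Zirr Zlt sep sum0 phi0; apply/eqP; case: eqP => // /eqP c0; exfalso.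
(* Invariant after [j] descents: the exponents in [A] agree from position [k - j] on, and the sum
   over [A] without those factors vanishes on [Z (k - j)]. At [j = k] one exponent is left, with an
   empty product. *)
suff H j : (j <= k)%N -> exists A : {set {ffun 'I_k -> 'I_D}},
    [/\ exists phi, phi \in A, forall phi, phi \in A -> c phi != 0,
     forall phi psi (i : 'I_k), phi \in A -> psi \in A -> (k - j <= i)%N ->
       phi i = psi i &
     forall x, Z (k - j)%N x -> (\sum_(phi in A)
       c phi *: \prod_(i < k | (i < k - j)%N) a i ^+ phi i).@[fun i => x i 0]
       = 0].
  have [A [[phi Aphi] cA agree]] := H k (leqnn k); rewrite subnn => vanish.
  have [[_ [x Zx] _] _] := Zirr 0 (leq0n k).
  have := vanish x Zx; rewrite (big_pred1 phi) => [|psi].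
    rewrite big_pred0 // mevalZ meval1 mulr1; exact/eqP/cA.
  apply/idP/eqP => [Apsi|-> //]; apply/ffunP => i.
  by apply: agree => //; rewrite subnn.
elim: j => [_|j IHj lt_jk].
  exists (finset (fun phi => c phi != 0)); split=> [|phi|phi psi i _ _|x Zx].
  - by exists phi0; rewrite inE.
  - by rewrite inE.
  - by rewrite subn0 leqNgt ltn_ord.
  - rewrite -[RHS](meval0 (fun i => x i 0)); congr meval; rewrite -[RHS]sum0.
    rewrite [RHS](bigID (fun phi => c phi != 0)) /= [X in _ + X]big1 ?addr0.
      apply: eq_big => [phi|phi _]; first by rewrite inE.
      by congr (_ *: _); apply: eq_bigl => i; rewrite subn0 ltn_ord.
    by move=> phi; rewrite negbK => /eqP ->; rewrite scale0r.
have [A [[phi1 Aphi1] cA agree vanish]] := IHj (ltnW lt_jk).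
set l := (k - j.+1)%N; have lS : (k - j)%N = l.+1 by rewrite subnSK.
have lt_lk : (l < k)%N by rewrite -lS leq_subr.
pose il := Ordinal lt_lk.
have [phim Am minm] :=
  arg_minnP (fun phi : {ffun 'I_k -> 'I_D} => phi il : nat) Aphi1.
have [al0 [y Zy aly]] := sep l lt_lk.
exists (finset (fun phi => (phi \in A) && (phi il == phim il))); split.
- by exists phim; rewrite inE eqxx andbT.
- by move=> phi; rewrite inE => /andP[/cA].
- move=> phi psi i; rewrite !inE => /andP[Aphi /eqP e1] /andP[Apsi /eqP e2].
  rewrite leq_eqVlt => /orP[/eqP e|lt_li]; last by apply: agree; rewrite ?lS.
  by have -> : i = il; [apply: val_inj | rewrite e1 e2].
pose q := \sum_(phi in A) c phi *: (a l ^+ (phi il - phim il) *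
  \prod_(i < k | (i < l)%N) a i ^+ phi i).
have Zirr1 := (Zirr l.+1 lt_lk).1.
have q0 x : Z l.+1 x -> q.@[fun i => x i 0] = 0.
  have prod0 z : Z l.+1 z -> (a l ^+ phim il).@[fun i => z i 0] *
      q.@[fun i => z i 0] = 0.
    move=> Zz; rewrite -mevalM -[RHS](vanish z) ?lS //; congr meval.
    rewrite mulr_sumr; apply: eq_bigr => phi Aphi.
    rewrite -scalerAr mulrA -exprD subnKC ?minm //; congr (_ *: _).
    rewrite [RHS](bigD1 il) /=; last by rewrite ltnS.
    congr (_ * _); apply: eq_bigl => i.
    by rewrite ltnS [in RHS]leq_eqVlt -(inj_eq val_inj) /=; case: ltngtP.
  have [p0|] := irreducible_closed_mul0 Zirr1 prod0; last exact.
  have /eqP := p0 y Zy; rewrite rmorphXn expf_eq0 => /andP[_].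
  by rewrite (negbTE aly).
move=> x Zx; have Zx1 : Z l.+1 x by have [+ _] := Zlt l lt_lk; apply.
rewrite -[RHS](q0 x Zx1) /q !raddf_sum /=.
rewrite [RHS](bigID (fun phi : {ffun 'I_k -> 'I_D} => phi il == phim il)) /=.
rewrite [X in _ = _ + X]big1 ?addr0.
  apply: eq_big => [phi|phi]; first by rewrite inE.
  rewrite inE => /andP[_ /eqP ->].
  by rewrite subnn expr0 mul1r.
move=> phi /andP[Aphi ne]; rewrite mevalZ mevalM rmorphXn /= al0 //.
rewrite expr0n subn_eq0 leqNgt ltn_neqAle minm // andbT.
by rewrite eq_sym (inj_eq val_inj) ne mul0r mulr0.
Qed.

Lemma msizeM_leD (F : idomainType) (n e f : nat) (p q : {mpoly F[n]}) :
  (msize p <= e.+1)%N -> (msize q <= f.+1)%N -> (msize (p * q) <= (e + f).+1)%N.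
Proof.
move=> pe qf; have [->|p0] := eqVneq p 0; first by rewrite mul0r msize0.
have [->|q0] := eqVneq q 0; first by rewrite mulr0 msize0.
rewrite msizeM //; have := leq_add pe qf; rewrite addSn addnS.
by case: (msize p + msize q)%N.
Qed.

Lemma msize_prod_exp_le (F : idomainType) (n k A D : nat)
    (a : nat -> {mpoly F[n]}) (phi : {ffun 'I_k -> 'I_D}) :
  (forall i, (i < k)%N -> (msize (a i) <= A.+1)%N) ->
  (msize (\prod_(i < k) a i ^+ phi i) <= (k * A * D).+1)%N.
Proof.
move=> aA; apply: (@leq_trans (\sum_(i < k) A * phi i).+1%N).
  elim/big_rec2: _ => [|i e p _ IH]; first by rewrite msize1.
  apply: msizeM_leD => //; elim: (nat_of_ord (phi i)) => [|j IHj].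
    by rewrite expr0 msize1.
  by rewrite exprS mulnS; apply: msizeM_leD => //; apply: aA.
rewrite ltnS -mulnA -[X in (X * _)%N]card_ord -sum_nat_const leq_sum // => i _.
by rewrite leq_mul2l ltnW ?orbT.
Qed.

Lemma card_bmultinom_le (n N : nat) : (#|{: 'X_{1..n < N}}| <= N ^ n)%N.
Proof.
(* The default of [insubd] is never taken: each exponent is at most the degree, hence below [N]. *)
pose f (m : 'X_{1..n < N}) : {ffun 'I_n -> 'I_N} :=
  [ffun i => insubd (Ordinal (leq_ltn_trans (leq0n _) (bmdeg m))) (m i)].
have f_inj : injective f.
  move=> m1 m2 /ffunP eq_f; apply/val_inj/mnmP => i.
  have lt (m : 'X_{1..n < N}) : (m i < N)%N.
    apply: leq_ltn_trans (bmdeg m); rewrite mdegE (bigD1 i) //=.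
    exact: leq_addr.
  by have /(congr1 val) := eq_f i; rewrite !ffunE !val_insubd !lt.
by have := leq_card f f_inj; rewrite card_ffun !card_ord.
Qed.

(** There are [D^(n+1)] products with exponents below [D], all of degree below some [N] linear in
    [D]. They lie in a space of dimension at most [N^n], which is smaller for a suitable [D]. *)
Lemma mpoly_alg_dependent (F : fieldType) (n : nat) (a : nat -> {mpoly F[n]}) :
  exists D : nat, exists c : {ffun 'I_n.+1 -> 'I_D} -> F,
    \sum_phi c phi *: \prod_(i < n.+1) a i ^+ phi i = 0 /\
    exists phi, c phi != 0.
Proof.
pose A := (\max_(i < n.+1) msize (a i))%N.
have [D ltD] := expn_lin_lt (n.+1 * A) n; exists D.
pose b (phi : {ffun 'I_n.+1 -> 'I_D}) := \prod_(i < n.+1) a i ^+ phi i.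
set N := (n.+1 * A * D).+1.
have bN phi : (msize (b phi) <= N)%N.
  apply: msize_prod_exp_le => i lt_in; apply/leqW.
  exact: (leq_bigmax (Ordinal lt_in)).
(* Each row lists the coefficients of one product; a nonzero vector of the left kernel is the
   relation. *)
pose M : 'M[F]_(#|{: {ffun 'I_n.+1 -> 'I_D}}|, #|{: 'X_{1..n < N}}|) :=
  \matrix_(i, j) (b (enum_val i))@_(bmnm (enum_val j)).
have : kermx M != 0.
  rewrite -mxrank_eq0 mxrank_ker subn_eq0 -ltnNge.
  apply: leq_ltn_trans (rank_leq_col M) _.
  apply: leq_ltn_trans (card_bmultinom_le n N) _.
  by rewrite card_ffun !card_ord.
case/rowV0Pn => v /sub_kermxP vM v0.
exists (fun phi => v 0 (enum_rank phi)); split; last first.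
  have [i vi] : exists i, v 0 i != 0 by apply/rV0Pn.
  by exists (enum_val i); rewrite enum_valK.
apply/mpolyP => m; rewrite mcoeff0 raddf_sum /=.
have [lt_mN|ge_mN] := ltnP (mdeg m) N; last first.
  apply: big1 => phi _; rewrite mcoeffZ memN_msupp_eq0 ?mulr0 //.
  exact: msize_mdeg_ge (leq_trans (bN phi) ge_mN).
have := congr1 (fun w : 'rV_ _ => w 0 (enum_rank (BMultinom lt_mN))) vM.
rewrite !mxE => M0.
rewrite -[RHS]M0 (reindex _ (onW_bij _ (enum_val_bij _))) /=.
by apply: eq_bigr => i _; rewrite mcoeffZ mxE enum_valK enum_rankK.
Qed.

Lemma irreducible_chain_le (F : fieldType) (n k : nat) (V : set 'cV[F]_n) :
  has_irreducible_chain V k -> (k <= n)%N.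
Proof.
case=> Z [Zirr Zlt]; rewrite leqNgt; apply/negP => lt_nk.
(* A longer chain is cut off after [n.+1] steps. *)
have Zirr1 i : (i <= n.+1)%N -> irreducible_closed (Z i) /\ Z i `<=` V.
  by move=> le_in; apply/Zirr/(leq_trans le_in).
have Zlt1 i : (i < n.+1)%N -> Z i `<` Z i.+1.
  by move=> lt_in; apply/Zlt/(leq_trans lt_in).
have [a sep] := chain_separating Zirr1 Zlt1.
have [D [c [sum0 [phi /negP[]]]]] := mpoly_alg_dependent a.
exact/eqP/(chain_alg_indep Zirr1 Zlt1 sep sum0).
Qed.

(** * Powers of X dividing a polynomial *)

(** In characteristic 0 the values [0, 1, ..., size p - 1] are distinct, one root too many for a
    nonzero [p]. *)
Lemma poly_vanish (F : numFieldType) (p : {poly F}) :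
  (forall x, p.[x] = 0) -> p = 0.
Proof.
move=> p0; apply: (@roots_geq_poly_eq0 F p [seq i%:R | i <- iota 0 (size p)]).
- by apply/allP => x _; apply/rootP.
- rewrite map_inj_uniq ?iota_uniq // => i j /eqP.
  by rewrite Num.Theory.eqr_nat => /eqP.
- by rewrite size_map size_iota.
Qed.

Lemma dvdp_XnP (F : fieldType) (e : nat) (p : {poly F}) :
  reflect (forall j, (j < e)%N -> p`_j = 0) ('X^e %| p).
Proof.
apply: (iffP idP) => [/dvdpP[q ->] j lt_je|p0]; first by rewrite coefMXn lt_je.
rewrite -[p](poly_take_drop e) (_ : take_poly e p = 0) ?add0r ?dvdp_mull //.
by apply/polyP => j; rewrite coef_take_poly coef0; case: ltnP => // /p0.
Qed.

(** For [p] in two variables, [map_poly (horner_eval t)] fixes the inner one, [p.[s%:P]] the outer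
    one, and [p.['X]] equates them. As the field is infinite, every monomial of [p] has outer
    exponent at least [a] and inner exponent at least [b]. *)
Lemma dvdp_Xn_diag2 (F : numFieldType) (a b : nat) (p : {poly {poly F}}) :
  (forall t, 'X^a %| map_poly (horner_eval t) p) ->
  (forall s, 'X^b %| p.[s%:P]) -> 'X^(a + b) %| p.['X].
Proof.
move=> pa pb.
have {}pa j : (j < a)%N -> p`_j = 0.
  move=> lt_ja; apply: poly_vanish => t.
  by have /dvdp_XnP/(_ j lt_ja) := pa t; rewrite coef_map.
have {}pb j : 'X^b %| p`_j.
  apply/dvdp_XnP => l lt_lb.
  (* The inner coefficients of degree [l], collected into a polynomial in the outer variable, vanish
     at every [s]. *)
  suff : \poly_(i < size p) p`_i`_l = 0.
    move=> /(congr1 (fun q : {poly F} => q`_j)); rewrite coef0 coef_poly.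
    by case: ltnP => // le_j; rewrite [p`_j]nth_default ?coef0.
  apply: poly_vanish => s; rewrite horner_poly.
  have /dvdp_XnP/(_ l lt_lb) := pb s; rewrite horner_coef coef_sum => ps.
  rewrite -[RHS]ps.
  by apply: eq_bigr => i _; rewrite -rmorphXn coefMC.
rewrite horner_coef; apply: (big_ind (fun q => 'X^(a + b) %| q)) => [||j _].
  exact: dvdp0.
  by move=> x y *; apply: dvdp_add.
have [/pa ->|le_aj] := ltnP j a; first by rewrite mul0r dvdp0.
by rewrite exprD mulrC dvdp_mul // dvdp_exp2l.
Qed.

Lemma rmorph_mmap (n : nat) (A B C : comNzRingType) (f : {rmorphism A -> B})
    (phi : {rmorphism B -> C}) (h : 'I_n -> B) (p : {mpoly A[n]}) :
  phi (mmap f h p) = mmap (phi \o f) (phi \o h) p.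
Proof.
rewrite /mmap rmorph_sum; apply: eq_bigr => m _; rewrite rmorphM /=.
by rewrite rmorph_prod; congr (_ * _); apply: eq_bigr => i _; rewrite rmorphXn.
Qed.

Lemma eq_mmap (n : nat) (A B : nzRingType) (f g : A -> B) (h k : 'I_n -> B)
    (p : {mpoly A[n]}) : f =1 g -> h =1 k -> mmap f h p = mmap g k p.
Proof.
move=> fg hk; apply: eq_bigr => m _; rewrite fg; congr (_ * _).
exact: mmap1_eq.
Qed.

Lemma dvdp_Xn_diag (F : numFieldType) (n : nat) (e : 'I_n -> nat)
    (p : {mpoly F[n]}) :
  (forall i v, 'X^(e i) %|
     mmap (@polyC F) (fun k => if k == i then 'X else (v k)%:P) p) ->
  'X^(\sum_i e i) %| mmap (@polyC F) (fun=> 'X) p.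
Proof.
move=> pe; suff H (r : seq 'I_n) : uniq r -> forall v,
    'X^(\sum_(i <- r) e i) %|
      mmap (@polyC F) (fun k => if k \in r then 'X else (v k)%:P) p.
  rewrite -big_enum; have := H (enum 'I_n) (enum_uniq _) (fun=> 0).
  by congr (_ %| _); apply: eq_mmap => // k; rewrite mem_enum.
elim: r => [_ v|i r IHr /= /andP[nir uniq_r] v].
  by rewrite big_nil expr0 dvd1p.
(* The outer variable stands for all indices in [r], the inner one for [i]; equating them gives the
   case [i :: r]. *)
pose q : {poly {poly F}} := mmap (polyC \o polyC)
  (fun k => if k \in r then 'X else if k == i then 'X%:P else (v k)%:P%:P) p.
have -> : mmap (@polyC F) (fun k => if k \in i :: r then 'X else (v k)%:P) p
    = q.['X].
  rewrite -horner_evalE rmorph_mmap; apply: eq_mmap => [c|k] /=.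
    by rewrite horner_evalE hornerC.
  rewrite inE horner_evalE; case: (k \in r); rewrite ?orbT ?hornerX ?orbF //.
  by case: eqP; rewrite hornerC.
rewrite big_cons addnC; apply: dvdp_Xn_diag2 => [t|s].
  have := IHr uniq_r (fun k => if k == i then t else v k).
  congr (_ %| _); rewrite rmorph_mmap; apply: eq_mmap => [c|k] /=.
    by rewrite map_polyC /= horner_evalE hornerC.
  case: (k \in r); first by rewrite map_polyX.
  by case: eqP; rewrite map_polyC /= horner_evalE ?hornerX ?hornerC.
have := pe i (fun k => if k \in r then s else v k).
congr (_ %| _); rewrite -horner_evalE rmorph_mmap; apply: eq_mmap => [c|k] /=.
  by rewrite horner_evalE hornerC.
rewrite horner_evalE; have [->|_] := eqVneq k i.
  by rewrite (negbTE nir) hornerC.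
by case: (k \in r); rewrite ?hornerX ?hornerC.
Qed.

(** Stated over a domain because the roots used later are themselves polynomials in [eps]. *)
Lemma prod_XsubC_factor (A : idomainType) (p : {poly A}) (rs : seq A) :
  uniq rs -> all (root p) rs ->
  exists q, p = q * \prod_(r <- rs) ('X - r%:P).
Proof.
elim: rs p => [|r rs IH] p /=; first by exists p; rewrite big_nil mulr1.
move=> /andP[nr_rs uniq_rs] /andP[/factor_theorem[q ->] roots].
have [|q' ->] := IH q uniq_rs.
  apply/allP => x x_rs; have := allP roots x x_rs.
  rewrite rootM root_XsubC => /orP[//|/eqP xr].
  by rewrite -xr x_rs in nr_rs.
by exists q'; rewrite big_cons -mulrA [_ * ('X - _)]mulrC.
Qed.

(** With the inner variable read as [eps], every factor ['X - r%:P] of [p] degenerates to ['X] at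
    [eps = 0]. *)
Lemma dvdp_Xn_degenerate (F : fieldType) (p : {poly {poly F}})
    (rs : seq {poly F}) :
  uniq rs -> all (root p) rs -> (forall r, r \in rs -> r.[0] = 0) ->
  'X^(size rs) %| map_poly (horner_eval 0) p.
Proof.
move=> uniq_rs /(prod_XsubC_factor uniq_rs)[q ->] rs0.
rewrite rmorphM rmorph_prod /= (eq_big_seq (fun=> 'X)).
  by rewrite big_const_seq count_predT iter_mulr_1 dvdp_mull.
move=> r /rs0 r0; rewrite rmorphB /= map_polyX map_polyC /= horner_evalE r0.
by rewrite subr0.
Qed.

(** * The resultant of forms vanishing on a coordinate subspace *)

(** [P] has integer coefficients, so its evaluation commutes with ring morphisms; all
    specialisations of the resultant below rest on this. *)
Lemma coef_eval_rmorph (A B : comNzRingType) (phi : {rmorphism A -> B})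
    (n d : nat) (P : form_coef_poly n d) (f : 'I_n -> {mpoly A[n]}) :
  phi (coef_eval P f) = coef_eval P (fun i => map_mpoly phi (f i)).
Proof.
rewrite /coef_eval /mmap rmorph_sum; apply: eq_bigr => m _.
rewrite rmorphM rmorph_int /mmap1 rmorph_prod; congr (_ * _).
by apply: eq_bigr => i _; rewrite rmorphXn mcoeff_map_mpoly.
Qed.

Lemma eq_coef_eval (A : comNzRingType) (n d : nat) (P : form_coef_poly n d)
    (f g : 'I_n -> {mpoly A[n]}) :
  f =1 g -> coef_eval P f = coef_eval P g.
Proof.
move=> fg; rewrite /coef_eval /mmap; apply: eq_bigr => m _.
by congr (_ * _); apply: mmap1_eq => k; rewrite fg.
Qed.

Lemma map_mpoly_comp_rmorph (A B C : comNzRingType) (n : nat)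
    (f : {rmorphism A -> B}) (g : {rmorphism B -> C}) (p : {mpoly A[n]}) :
  map_mpoly g (map_mpoly f p) = map_mpoly (g \o f) p.
Proof. by apply/mpolyP => m; rewrite !mcoeff_map_mpoly. Qed.

Lemma eq_map_mpoly (A B : comNzRingType) (n : nat)
    (f g : {rmorphism A -> B}) (p : {mpoly A[n]}) :
  f =1 g -> map_mpoly f p = map_mpoly g p.
Proof.
by move=> fg; apply/mpolyP => m; rewrite !mcoeff_map_mpoly; apply: fg.
Qed.

(** The degree is [d.+1], so [d] is one less than in the opening outline. The distinct powers of
    [eps] make the root attached to [phi] a polynomial in [eps] with the values of [phi] as
    coefficients. *)
Definition perturbed_system (A : comNzRingType) (n d : nat) (i : 'I_n)
    (s eps : A) (v : 'I_n -> A) (h : 'I_n -> {mpoly A[n]}) (k : 'I_n) :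
    {mpoly A[n]} :=
  (if k == i then s *: 'X_i ^+ d.+1
     - 'X_i ^+ d * \sum_(j < n | j != i) eps ^+ j.+1 *: 'X_j
   else v k *: \prod_(r < d.+1) ('X_k - (r%:R * eps) *: 'X_i)) + h k.

Lemma map_perturbed_system (A B : comNzRingType) (phi : {rmorphism A -> B})
    (n d : nat) (i : 'I_n) (s eps : A) (v : 'I_n -> A)
    (h : 'I_n -> {mpoly A[n]}) (k : 'I_n) :
  map_mpoly phi (perturbed_system d i s eps v h k) =
  perturbed_system d i (phi s) (phi eps) (phi \o v)
    (fun k => map_mpoly phi (h k)) k.
Proof.
rewrite /perturbed_system rmorphD; congr (_ + _); case: eqP => _.
  rewrite rmorphB rmorphM /= map_mpolyZ !rmorphXn /= map_mpolyX rmorph_sum /=.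
  congr (_ - _ * _); apply: eq_bigr => j _.
  by rewrite map_mpolyZ rmorphXn /= map_mpolyX.
rewrite /= map_mpolyZ rmorph_prod; congr (_ *: _); apply: eq_bigr => r _.
by rewrite rmorphB /= map_mpolyZ !map_mpolyX rmorphM rmorph_nat.
Qed.

Lemma perturbed_system0 (A : comNzRingType) (n d : nat) (i : 'I_n) (s : A)
    (v : 'I_n -> A) (h : 'I_n -> {mpoly A[n]}) (k : 'I_n) :
  perturbed_system d i s 0 v h k =
  (if k == i then s else v k) *: 'X_k ^+ d.+1 + h k.
Proof.
rewrite /perturbed_system; congr (_ + _); case: eqP => [->|_].
  by rewrite big1 ?mulr0 ?subr0 // => j _; rewrite expr0n scale0r.
congr (_ *: _); under eq_bigr do rewrite mulr0 scale0r subr0.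
by rewrite prodr_const card_ord.
Qed.

Lemma perturbed_system_homog (F : fieldType) (n d : nat) (i : 'I_n)
    (s eps : F) (v : 'I_n -> F) (h : 'I_n -> {mpoly F[n]}) (k : 'I_n) :
  h k \is d.+1.-homog -> perturbed_system d i s eps v h k \is d.+1.-homog.
Proof.
move=> hk; have X1 (j : 'I_n) : ('X_j : {mpoly F[n]}) \is 1.-homog.
  by rewrite dhomogX /= mdeg1.
have XE (e : nat) (j : 'I_n) : ('X_j ^+ e : {mpoly F[n]}) \is e.-homog.
  by have := dhomogMn e (X1 j); rewrite mul1n.
apply: rpredD => //; case: eqP => _.
  apply: rpredB; first exact: rpredZ.
  rewrite -addn1; apply: dhomogM => //.
  by apply: rpred_sum => j _; apply: rpredZ.
apply: rpredZ; suff : \prod_(r < d.+1) ('X_k - (r%:R * eps) *: 'X_i)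
    \is (\sum_(r < d.+1) 1)%N.-homog by rewrite sum1_card card_ord.
elim/big_rec2: _ => [|r e p _ IH]; first exact: dhomog1.
by apply: dhomogM => //; apply: rpredB => //; apply: rpredZ.
Qed.

(* The points [x_i = 1], [x_k = eps * phi_k] make every equation but the
   [i]-th one vanish, and the [i]-th one then determines [s]. *)
Lemma perturbed_system_zero (F : fieldType) (n d : nat) (i : 'I_n)
    (eps : F) (v : 'I_n -> F) (h : 'I_n -> {mpoly F[n]})
    (phi : {ffun 'I_n -> 'I_d.+1}) (k : 'I_n) :
  let x j := if j == i then 1 else (phi j)%:R * eps in
  (h k).@[x] = 0 ->
  (perturbed_system d i (\sum_(j < n | j != i) (phi j)%:R * eps ^+ j.+2) eps v
     h k).@[x] = 0.
Proof.
move=> x hk0; rewrite /perturbed_system mevalD hk0 addr0.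
have xi : x i = 1 by rewrite /x eqxx.
case: eqP => [_|/eqP ki].
  rewrite mevalB mevalZ mevalM !rmorphXn /= mevalXU xi !expr1n mulr1 mul1r.
  apply/eqP; rewrite subr_eq0 [X in _ == X]raddf_sum; apply/eqP.
  apply: eq_bigr => j ji.
  by rewrite /= mevalZ mevalXU /x (negbTE ji) [RHS]mulrCA -exprSr.
(* The factor with [r = phi k] vanishes at [x]. *)
rewrite mevalZ rmorph_prod (bigD1 (phi k)) //= mevalB mevalZ !mevalXU xi.
by rewrite /x (negbTE ki) mulr1 subrr mul0r mulr0.
Qed.

Section ResultantVanishing.
Context (F : numFieldType) (n d : nat) (Res : form_coef_poly n d.+1).
Context (h : 'I_n -> {mpoly F[n]}) (S : {set 'I_n}).
Hypothesis hRes : is_resultant F Res.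
Hypothesis h_homog : forall k, h k \is d.+1.-homog.
Hypothesis h0 : forall (x : 'I_n -> F) k,
  (forall j, j \notin S -> x j = 0) -> (h k).@[x] = 0.

Lemma resultant_dvd_Xn (i : 'I_n) (v : 'I_n -> F) : i \in S ->
  'X^(d.+1 ^ #|S :\ i|) %| coef_eval Res (fun k =>
     (if k == i then 'X else (v k)%:P) *: 'X_k ^+ d.+1
       + map_mpoly (@polyC F) (h k)).
Proof.
move=> iS; pose A := {poly {poly F}}.
(* The perturbed resultant, with outer variable [s_i] and inner variable [eps]. *)
pose B : A := coef_eval Res (perturbed_system d i 'X ('X%:P)
  (fun k => (v k)%:P%:P) (fun k => map_mpoly (polyC \o polyC) (h k))).
pose rt (phi : {ffun 'I_n -> 'I_d.+1}) : {poly F} :=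
  \sum_(j < n | j != i) (phi j)%:R * 'X^(j.+2).
(* Functions equal to [0] off [S :\ i], so that the points built from them lie in the coordinate
   subspace. *)
pose Phi := pffun_on (ord0 : 'I_d.+1) (mem (S :\ i)) predT.
pose rs := [seq rt phi | phi <- enum Phi].
have Phi0 phi j : phi \in Phi -> j \notin S :\ i -> phi j = ord0.
  by move=> /pffun_onP[/supportP sub _] /sub.
have size_rs : size rs = (d.+1 ^ #|S :\ i|)%N.
  rewrite size_map -cardE card_pffun_on; congr (_ ^ _)%N.
  by rewrite -[RHS](card_ord d.+1); apply: eq_card.
have -> : coef_eval Res (fun k =>
     (if k == i then 'X else (v k)%:P) *: 'X_k ^+ d.+1
       + map_mpoly (@polyC F) (h k)) = map_poly (horner_eval 0) B.
  rewrite coef_eval_rmorph; apply: eq_coef_eval => k.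
  rewrite map_perturbed_system /= map_polyX map_polyC /= horner_evalE hornerX.
  rewrite perturbed_system0 /= map_polyC /= horner_evalE hornerC.
  congr (_ + _); rewrite map_mpoly_comp_rmorph; apply: eq_map_mpoly => c /=.
  by rewrite map_polyC /= horner_evalE hornerC.
rewrite -size_rs; apply: dvdp_Xn_degenerate.
- rewrite map_inj_in_uniq ?enum_uniq // => phi psi.
  rewrite !mem_enum => Phi_phi Phi_psi eq_rt; apply/ffunP => j.
  have [->|ji] := eqVneq j i; first by rewrite !Phi0 // !inE eqxx.
  (* The coefficients of a root recover [f], so distinct functions give distinct roots. *)
  have rtE f : (rt f)`_j.+2 = (f j)%:R.
    rewrite coef_sum (bigD1 j) //= big1 ?addr0.
      by rewrite -polyC_natr mul_polyC coefZ coefXn eqxx mulr1.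
    move=> l /andP[_ lj]; rewrite -polyC_natr mul_polyC coefZ coefXn.
    by rewrite !eqSS eq_sym (inj_eq val_inj) (negbTE lj) mulr0.
  apply/val_inj/eqP; rewrite -(Num.Theory.eqr_nat F); apply/eqP.
  by rewrite -!rtE eq_rt.
- apply/allP => _ /mapP[phi + ->]; rewrite mem_enum => Phi_phi.
  (* The vanishing criterion of [Res] is given over the field [F], so the root is tested at each
     value of [eps]. *)
  apply/rootP/poly_vanish => eps.
  rewrite -[RHS](_ : horner_eval eps (horner_eval (rt phi) B) = 0) //.
  rewrite !coef_eval_rmorph.
  rewrite (@eq_coef_eval _ _ _ _ _ (perturbed_system d i
    (\sum_(j < n | j != i) (phi j)%:R * eps ^+ j.+2) eps v h)); last first.
    move=> k; rewrite !map_perturbed_system /= !horner_evalE hornerX !hornerC.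
    have -> : (rt phi).[eps] =
        \sum_(j < n | j != i) (phi j)%:R * eps ^+ j.+2.
      rewrite -horner_evalE raddf_sum; apply: eq_bigr => j _ /=.
      by rewrite horner_evalE hornerM hornerXn -polyC_natr hornerC.
    rewrite hornerX /perturbed_system /= !horner_evalE !hornerC.
    congr (_ + _); apply/mpolyP => m.
    by rewrite !mcoeff_map_mpoly /= !horner_evalE !hornerC.
  pose x j : F := if j == i then 1 else (phi j)%:R * eps.
  have [_ /(_ (perturbed_system d i (\sum_(j < n | j != i)
    (phi j)%:R * eps ^+ j.+2) eps v h)) zeros _] := hRes.
  apply/zeros.
    by move=> k; apply: perturbed_system_homog.
  exists (\col_j x j); split.
    apply/eqP => /colP/(_ i); rewrite !mxE /x eqxx; apply/eqP.
    exact: oner_neq0.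
  move=> k; rewrite (meval_eq (v2 := x)) => [|j]; last by rewrite mxE.
  apply: perturbed_system_zero; apply: h0 => j jS.
  rewrite /x; case: eqP => [ji|_]; first by rewrite ji iS in jS.
  by rewrite Phi0 ?mul0r // inE negb_and jS orbT.
(* All exponents [j.+2] are positive, so every root vanishes at [eps = 0]. *)
- move=> _ /mapP[phi _ ->]; rewrite -horner_evalE raddf_sum big1 //= => j _.
  by rewrite horner_evalE hornerM hornerXn expr0n mulr0.
Qed.

Lemma resultant_dvd_Xn_card :
  'X^(#|S| * d.+1 ^ #|S|.-1) %| coef_eval Res (fun k =>
     'X *: 'X_k ^+ d.+1 + map_mpoly (@polyC F) (h k)).
Proof.
(* One unknown per equation; [PE] serves both for freezing all unknowns but one and for equating
   them all. *)
pose P : {mpoly F[n]} := coef_eval Res (fun k =>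
  'X_k *: 'X_k ^+ d.+1 + map_mpoly (@mpolyC n F) (h k)).
have PE (u : 'I_n -> {poly F}) : mmap (@polyC F) u P =
    coef_eval Res (fun k => u k *: 'X_k ^+ d.+1 + map_mpoly (@polyC F) (h k)).
  rewrite coef_eval_rmorph; apply: eq_coef_eval => k.
  rewrite rmorphD /= map_mpolyZ rmorphXn /= map_mpolyX mmapX mmap1U.
  congr (_ + _); rewrite map_mpoly_comp_rmorph.
  by apply: eq_map_mpoly => c /=; rewrite mmapC.
rewrite -(PE (fun=> 'X)).
have := @dvdp_Xn_diag F n (fun i => (i \in S) * d.+1 ^ #|S|.-1)%N P.
have sumS : (\sum_(i < n) (i \in S))%N = #|S|.
  by rewrite -sum1_card [RHS]big_mkcond; apply: eq_bigr => i _; case: (i \in S).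
rewrite -big_distrl /= sumS; apply=> i v; rewrite PE.
have [iS|_] := boolP (i \in S); last first.
  by rewrite mul0n expr0 dvd1p.
by rewrite mul1n (cardsD1 i S) iS add1n; apply: resultant_dvd_Xn.
Qed.

End ResultantVanishing.

(** * Tensors *)

Lemma tensor_form_id (A : comNzRingType) (n m : nat) (i : 'I_n) :
  tensor_form (id_tensor A n m.+1) i = 'X_i ^+ m.
Proof.
rewrite /tensor_form (bigD1 [tuple of nseq m.+1 i]) //= [X in _ + X]big1 ?addr0.
  rewrite ffunE (_ : constant _ = true); last exact: (constant_nseq m.+1 i).
  rewrite scale1r -[LHS]/(\prod_(k <- nseq m i) 'X_k).
  by rewrite big_nseq iter_mulr_1.
move=> j /andP[hd_j ne_j]; rewrite ffunE.
case: (boolP (constant j)) => [const_j|_]; last by rewrite scale0r.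
case/eqP: ne_j; apply: val_inj => /=.
case: j hd_j const_j => [[|k s]] //= /eqP[size_s] /eqP[->].
by move=> /all_pred1P ->; rewrite size_s.
Qed.

Lemma tensor_form_homog (F : fieldType) (n m : nat) (T : tensor F n m)
    (i : 'I_n) : tensor_form T i \is m.-1.-homog.
Proof.
apply: rpred_sum => j _; apply: rpredZ.
have <- : size (behead j) = m.-1 by rewrite size_behead size_tuple.
elim: (behead j) => [|k s IH]; first by rewrite big_nil dhomog1.
by rewrite big_cons; apply: (dhomogM (d := 1) _ IH); rewrite dhomogX /= mdeg1.
Qed.

Lemma tensor_applyE (A : comNzRingType) (n m : nat) (T : tensor A n m)
    (x : 'cV[A]_n) (i : 'I_n) :
  tensor_apply T x i 0 = (tensor_form T i).@[fun k => x k 0].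
Proof.
rewrite mxE raddf_sum; apply: eq_bigr => j _ /=.
rewrite mevalZ rmorph_prod; congr (_ * _).
by apply: eq_bigr => k _; rewrite /= mevalXU.
Qed.

(** * The characteristic polynomial as a resultant *)

Lemma tensor_char_polyE (F : fieldType) (n m : nat)
    (Res : form_coef_poly n m) (T : tensor F n m.+1) :
  tensor_char_poly (m := m.+1) Res T = coef_eval Res (fun k =>
    'X *: 'X_k ^+ m - map_mpoly (@polyC F) (tensor_form T k)).
Proof.
apply: eq_coef_eval => k; rewrite -tensor_form_id /tensor_form.
rewrite scaler_sumr [X in _ - X]raddf_sum -sumrB; apply: eq_bigr => j _ /=.
rewrite ffunE scalerBl scalerA map_mpolyZ rmorph_prod; congr (_ - _ *: _).
by apply: eq_bigr => l _; rewrite /= map_mpolyX.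
Qed.

Lemma horner_coef_eval (F : fieldType) (n d : nat) (P : form_coef_poly n d)
    (f : 'I_n -> {mpoly {poly F}[n]}) (t : F) :
  (coef_eval P f).[t] =
  coef_eval P (fun k => map_mpoly (horner_eval t) (f k)).
Proof. by rewrite -horner_evalE coef_eval_rmorph. Qed.

(* [Res (x^[m] - eps T x^m)] is [1] at [eps = 0], so [1 / eps] is not an
   eigenvalue for some [eps]. *)
Lemma tensor_char_poly_neq0 (F : numFieldType) (n m : nat)
    (Res : form_coef_poly n m) (T : tensor F n m.+1) :
  is_resultant F Res -> tensor_char_poly (m := m.+1) Res T != 0.
Proof.
case=> _ zeros norm; pose f eps k : {mpoly F[n]} :=
  'X_k ^+ m - eps *: tensor_form T k.
have Xhomog k : ('X_k ^+ m : {mpoly F[n]}) \is m.-homog.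
  have := @dhomogMn _ F mdeg 1 'X_k m; rewrite mul1n; apply.
  by rewrite dhomogX /= mdeg1.
pose p : {poly F} := coef_eval Res (fun k =>
  'X_k ^+ m - 'X *: map_mpoly (@polyC F) (tensor_form T k)).
have pE eps : p.[eps] = coef_eval Res (f eps).
  rewrite horner_coef_eval; apply: eq_coef_eval => k.
  rewrite rmorphB rmorphXn /= map_mpolyX map_mpolyZ /= horner_evalE hornerX.
  rewrite /f; congr (_ - _ *: _); apply/mpolyP => a.
  by rewrite !mcoeff_map_mpoly /= horner_evalE hornerC.
have p0 : p.[0] = 1.
  rewrite pE -[RHS]norm; apply: eq_coef_eval => k.
  by rewrite /f scale0r subr0.
(* The factor ['X] forces the [eps] chosen below to be nonzero. *)
have Xp0 : 'X * p != 0.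
  rewrite mulf_neq0 ?polyX_eq0 //; apply: contra_eq_neq p0 => ->.
  by rewrite horner0 eq_sym oner_eq0.
have [eps] : exists eps, ('X * p).[eps] != 0.
  apply: boolp.contrapT => /boolp.forallNP all0; case/eqP: Xp0.
  by apply: poly_vanish => eps; apply/eqP/negPn/negP/all0.
rewrite hornerM hornerX mulf_eq0 negb_or => /andP[eps0 p_eps].
apply/eqP => chi0; move/eqP: p_eps; apply; rewrite pE; apply/zeros.
  by move=> k; apply: rpredB; rewrite ?rpredZ //; apply: tensor_form_homog.
have [||x [x0 sol]] :=
  (zeros (fun k => eps^-1 *: 'X_k ^+ m - tensor_form T k) _).1.
- by move=> k; apply: rpredB; rewrite ?rpredZ //; apply: tensor_form_homog.
- have := congr1 (fun q : {poly F} => q.[eps^-1]) chi0; rewrite horner0.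
  rewrite tensor_char_polyE horner_coef_eval => chi_eps.
  rewrite -[RHS]chi_eps; apply: eq_coef_eval => k.
  rewrite rmorphB /= map_mpolyZ rmorphXn /= map_mpolyX horner_evalE hornerX.
  congr (_ - _); apply/mpolyP => a.
  by rewrite !mcoeff_map_mpoly /= horner_evalE hornerC.
exists x; split=> // k; have := congr1 (fun z => eps * z) (sol k).
by rewrite mulr0 -mevalZ scalerBr scalerA divff // scale1r.
Qed.

Lemma card_perm_lt (n g : nat) (s : 'S_n) : (g <= n)%N ->
  #|[pred k | (s k < g)%N]| = g.
Proof.
move=> le_gn; rewrite -sum1_card.
rewrite -(reindex_inj (@perm_inj _ s)
  (P := fun k : 'I_n => (k < g)%N) (F := fun _ => 1%N)) /=.
by rewrite -(big_ord_widen n (fun _ => 1%N) le_gn) sum1_card card_ord.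
Qed.

Unset Implicit Arguments.
Set Strict Implicit.

Theorem theorem5p6 (R : realType) (m n : nat) (hm : (2 <= m)%N)
    (hn : (1 <= n)%N)
    (Res : form_coef_poly n m.-1) (hRes : is_resultant R[i] Res)
    (T : tensor R[i] n m) (lam : R[i]) (hlam : is_eigenvalue T lam)
    (gm : nat) (hgm : is_geom_mult T lam gm)
    (hP : exists P : 'M[R[i]]_n, is_perm_mx P /\
       [set P *m x | x in coord_subspace R[i] n gm] `<=` eigenvariety T lam) :
  (gm * m.-1 ^ gm.-1 <= alg_mult Res T lam)%N.
Proof.
case: m hm Res hRes T hlam hgm hP => [|[|d]] // _ Res hRes T _ [chain _].
case=> P [/is_perm_mxP[s ->] sub].
(* Ensures that exactly [gm] indices satisfy [s k < gm]. *)
have le_gn := irreducible_chain_le chain.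
(* Entry [k] of [perm_mx s *m x] is [x (s k)], so [S] indexes the free coordinates of the permuted
   subspace. *)
pose S := finset [pred k | (s k < gm)%N].
have cardS : #|S| = gm by rewrite cardsE card_perm_lt.
pose h k : {mpoly R[i][n]} := lam *: 'X_k ^+ d.+1 - tensor_form T k.
have h_homog k : h k \is d.+1.-homog.
  apply: rpredB; last exact: tensor_form_homog.
  apply: rpredZ; have := @dhomogMn _ R[i] mdeg 1 'X_k d.+1; rewrite mul1n.
  by apply; rewrite dhomogX /= mdeg1.
have h0 (x : 'I_n -> R[i]) k : (forall j, j \notin S -> x j = 0) ->
    (h k).@[x] = 0.
  move=> x0; pose y : 'cV[R[i]]_n := \col_j x j.
  have /(congr1 (fun z : 'cV_n => z k 0)) : eigenvariety T lam y.
    apply: sub; exists (\col_j x ((s^-1)%g j)).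
      by move=> j le_gj; rewrite mxE x0 // !inE permKV -leqNgt.
    by apply/colP => j; rewrite -row_permE !mxE permK.
  rewrite tensor_applyE !mxE (meval_eq (v2 := x)) => [Tx|j].
  2: by rewrite mxE.
  by rewrite mevalB Tx mevalZ rmorphXn /= mevalXU subrr.
(* For a nonzero polynomial, multiplicity at least [e] means divisibility by the [e]-th power of
   ['X - lam%:P]. *)
rewrite mup_geq; last exact: tensor_char_poly_neq0.
have /dvdpP[q qE] := resultant_dvd_Xn_card hRes h_homog h0.
rewrite cardS in qE.
(* The substitution [s = t - lam]: [t x_k^(d+1) - f_k = (t - lam) x_k^(d+1) + h_k], where [f_k] is
   the form of [T]. *)
have -> : tensor_char_poly Res T =
    coef_eval Res (fun k => 'X *: 'X_k ^+ d.+1 + map_mpoly (@polyC R[i]) (h k))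
    \Po ('X - lam%:P).
  rewrite tensor_char_polyE.
  rewrite -[RHS]/(comp_poly _ _) coef_eval_rmorph; apply: eq_coef_eval => k.
  rewrite rmorphD /= map_mpolyZ rmorphXn /= map_mpolyX comp_polyX.
  rewrite map_mpoly_comp_rmorph.
  have -> : map_mpoly (comp_poly ('X - lam%:P) \o polyC) (h k) =
      map_mpoly (@polyC R[i]) (h k).
    by apply/mpolyP => a; rewrite !mcoeff_map_mpoly /= comp_polyC.
  rewrite /h rmorphB /= map_mpolyZ rmorphXn /= map_mpolyX.
  by rewrite addrA -scalerDl subrK.
by rewrite qE comp_polyM comp_Xn_poly dvdp_mull.
Qed.
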